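(* Let $S$ be a semigroup with zero. Then the following hold. (1) $\overrightarrow{\Gamma}_{E}(S)$ contains a directed cycle if and only if $\overrightarrow{\Gamma}(S)$ contains a directed cycle. (2) $\mathrm{Girth}(\overrightarrow{\Gamma}(S))\in\{2,3,4,\infty\}$, $\mathrm{Girth}(\overrightarrow{\Gamma}_{E}(S))\in\{2,3,4,\infty\}$, and $\mathrm{Girth}(\overrightarrow{\Gamma}_{E}(S))\leq\mathrm{Girth}(\overrightarrow{\Gamma}(S))$.
   Context: Let $S$ be a semigroup with zero, not necessarily commutative; for $A\subseteq S$, $A^{*}=A\setminus\{0\}$. An element $x\in S$ is a left (resp. right) zero divisor if $xy=0$ (resp. $yx=0$) for some $y\in S^{*}$; $Z(S)$ is the set of all elements that are left or right zero divisors. All digraphs are simple (no loops, no multiple arcs). The zero-divisor digraph $\overrightarrow{\Gamma}(S)$ has vertex set $Z(S)^{*}$, and for distinct $x,y\in Z(S)^{*}$, $x\to y$ is an arc if and only if $xy=0$. The extended zero-divisor digraph $\overrightarrow{\Gamma}_{E}(S)$ has the same vertex set, and for distinct $x,y\in Z(S)^{*}$, $x\to y$ is an arc if and only if $x^{n}y^{m}=0$ for some positive integers $n,m$ with $x^{n}\neq 0$ and $y^{m}\neq 0$. A directed cycle $x_1\to x_2\to\cdots\to x_k\to x_1$ has $k\geq 2$ distinct vertices and length $k$ (so $x\to y\to x$ is a directed cycle of length $2$). The girth of a digraph, $\mathrm{Girth}$, is the length of a shortest directed cycle, and is $\infty$ if there are no directed cycles. *)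

(* Defs.v *)
From mathcomp Require Import all_boot all_order all_algebra.
From mathcomp Require Import boolp classical_sets constructive_ereal.

Set Implicit Arguments.
Unset Strict Implicit.
Unset Printing Implicit Defensive.

(* The vertex set may be infinite; [arc_irrefl] excludes loops, while antiparallel
   pairs of arcs x -> y -> x are allowed. *)
Record digraph (T : Type) := Digraph {
  vertices : set T;
  arc : rel T;
  arc_vertices : forall x y, arc x y -> vertices x /\ vertices y;
  arc_irrefl : irreflexive arc
}.

Section Cycles.
Variables (T : eqType) (G : digraph T).

Definition dicycle (c : seq T) : bool := (2 <= size c) && ucycleb (arc G) c.

Definition has_dicycle : Prop := exists c, dicycle c.

Definition dicycle_length (k : nat) : bool :=
  `[< exists c, dicycle c /\ size c = k >].

(* [\bar int] is used only as a copy of the naturals with a top element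
   [+oo]; negative values and [-oo] never occur. *)
Definition girth : \bar int :=
  match pselect (exists k, dicycle_length k) with
  | left ex => ((ex_minn ex)%:Z)%:E
  | right _ => +oo%E
  end.

End Cycles.

Section ZeroDivisorDigraphs.
Variable S : semigroupType.
Local Open Scope group_scope.

Definition is_zero (z : S) : Prop :=
  left_zero z *%g /\ right_zero z *%g.

(* [S] need not have an identity, so [iterop] is given the dummy default [x]:
   [spow x n] is the usual power for [n > 0], and [spow x 0 = x] is junk. *)
Definition spow (x : S) (n : nat) : S := iterop n *%g x x.

Variable z : S.

Definition left_zero_divisor (x : S) : Prop := exists y, y <> z /\ x * y = z.
Definition right_zero_divisor (x : S) : Prop := exists y, y <> z /\ y * x = z.

Definition zd_vertices : set S :=
  [set x | (left_zero_divisor x \/ right_zero_divisor x) /\ x <> z]%classic.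

Definition zd_rel (x y : S) : Prop := x * y = z.

Definition ezd_rel (x y : S) : Prop :=
  exists n m, [/\ 0 < n, 0 < m, spow x n <> z, spow y m <> z
                & spow x n * spow y m = z].

Definition zd_arc (r : S -> S -> Prop) : rel S := fun x y =>
  `[< [/\ zd_vertices x, zd_vertices y, x <> y & r x y] >].

Lemma zd_arc_vertices (r : S -> S -> Prop) x y :
  zd_arc r x y -> zd_vertices x /\ zd_vertices y.
Proof. by case/asboolP. Qed.

Lemma zd_arc_irrefl (r : S -> S -> Prop) : irreflexive (zd_arc r).
Proof. by move=> x; apply/negP => /asboolP[]. Qed.

Definition zd_digraph : digraph S :=
  Digraph (@zd_arc_vertices zd_rel) (@zd_arc_irrefl zd_rel).

Definition ext_zd_digraph : digraph S :=
  Digraph (@zd_arc_vertices ezd_rel) (@zd_arc_irrefl ezd_rel).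

End ZeroDivisorDigraphs.

(* Main.v *)
Require Import Defs.
From mathcomp Require Import all_boot all_order all_algebra.
From mathcomp Require Import boolp classical_sets constructive_ereal.

(** A path of four distinct vertices [x1 -> x2 -> x3 -> x4] in either digraph
    already forces a directed cycle of length at most 4, which bounds both
    girths. In the zero-divisor digraph, put [w = x4 x1]. If [w = 0] then
    [x4 -> x1] closes a 4-cycle. Otherwise [x3 w = (x3 x4) x1 = 0] and
    [w x2 = x4 (x1 x2) = 0], so [x2 -> x3 -> w -> x2] is a 3-cycle, unless [w]
    is [x2] or [x3], and then [x3 x2 = 0] gives a 2-cycle.

    In the extended digraph a vertex [x_i] of a cycle carries two exponents, one
    for the incoming and one for the outgoing arc. Passing to the larger of the
    two keeps the power [y_i] of [x_i] nonzero and both products zero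
    ([power_lift]), so the argument above applies with [y_i] in place of [x_i]
    ([short_dicycle_of_path]).

    The elements [y_i] also yield a cycle in the zero-divisor digraph. They form
    a closed walk for the relation [u v = 0], but may coincide. If [y_1] and
    [y_2] differ, removing loops from the walk back from [y_2] to [y_1] leaves a
    cycle ([dicycle_of_walk]). If [y_1 = y_2] then this element squares to zero
    and is a proper power of [x_1] or of [x_2], because these are distinct; so
    one of them is nilpotent with nonzero square, and forms a 2-cycle with its
    last nonzero power ([dicycle_of_nilpotent]). *)

Set Implicit Arguments.
Unset Strict Implicit.
Unset Printing Implicit Defensive.

(** * Girth of a digraph *)

Section Girth.
Variable T : eqType.
Implicit Types G H : digraph T.

Lemma dicycle_lengthP G k :
  reflect (exists c, dicycle G c /\ size c = k) (dicycle_length G k).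
Proof. exact: asboolP. Qed.

Lemma girth_in_2_3_4_oo G :
  (has_dicycle G -> exists2 c, dicycle G c & size c <= 4) ->
  girth G \in [:: 2%:E; 3%:E; 4%:E; +oo]%E.
Proof.
move=> short; rewrite /girth; case: pselect => [ex|_]; last by rewrite !inE eqxx !orbT.
case: ex_minnP => k /dicycle_lengthP[c [Gc <-]] kmin.
have [c' Gc' c'4] := short (ex_intro _ c Gc).
have /kmin cc' : dicycle_length G (size c') by apply/dicycle_lengthP; exists c'.
have /andP[c2 _] := Gc.
move: (size c) c2 (leq_trans cc' c'4).
by do 5![case=> //].
Qed.

Lemma girth_mono G H :
  (forall c, dicycle G c -> dicycle H c) -> (girth H <= girth G)%E.
Proof.
move=> GH; rewrite /girth; case: (pselect (exists k, dicycle_length G k)) => [exG|_];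
  last by rewrite leey.
case: ex_minnP => k /dicycle_lengthP[c [/GH Hc <-]] _.
have Hk : dicycle_length H (size c) by apply/dicycle_lengthP; exists c.
case: pselect => [exH|[]]; last by exists (size c).
by rewrite lee_fin lez_nat; case: ex_minnP => m _; apply.
Qed.

End Girth.

(** * Powers and arcs *)

Section ZeroDivisors.
Variable S : semigroupType.
Variable z : S.
Hypothesis hz : is_zero z.
Local Open Scope group_scope.
Implicit Types (x y u v w : S) (n m : nat) (r : S -> S -> Prop).

Local Lemma mulz x : z * x = z. Proof. by case: hz => h _; apply: h. Qed.
Local Lemma mulxz x : x * z = z. Proof. by case: hz => _ h; apply: h. Qed.

Lemma spowS x n : 0 < n -> spow x n.+1 = x * spow x n.
Proof. by case: n. Qed.

Lemma spowD x n m : 0 < n -> 0 < m -> spow x (n + m) = spow x n * spow x m.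
Proof.
case: n => // n _ m0; elim: n => [|n IHn]; first by rewrite add1n spowS.
by rewrite [in LHS]addSn spowS // IHn mulgA -spowS.
Qed.

Lemma spowSr x n : 0 < n -> spow x n.+1 = spow x n * x.
Proof. by move=> n0; rewrite -addn1 spowD. Qed.

Lemma spow_mul0l x n m y :
  0 < n -> n <= m -> spow x n * y = z -> spow x m * y = z.
Proof.
move=> n0; rewrite leq_eqVlt => /predU1P[<- //|nm] xy0.
by rewrite -(subnK (ltnW nm)) spowD ?subn_gt0 // -mulgA xy0 mulxz.
Qed.

Lemma spow_mul0r x n m y :
  0 < n -> n <= m -> y * spow x n = z -> y * spow x m = z.
Proof.
move=> n0; rewrite leq_eqVlt => /predU1P[<- //|nm] yx0.
by rewrite -(subnKC (ltnW nm)) spowD ?subn_gt0 // mulgA yx0 mulz.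
Qed.

Lemma zd_vertexl u v : u <> z -> v <> z -> u * v = z -> zd_vertices z u.
Proof. by move=> u0 v0 uv; split=> //; left; exists v. Qed.

Lemma zd_vertexr u v : u <> z -> v <> z -> u * v = z -> zd_vertices z v.
Proof. by move=> u0 v0 uv; split=> //; right; exists u. Qed.

Lemma zd_arc_mul0 x y : x <> z -> y <> z -> x <> y -> x * y = z ->
  Defs.arc (zd_digraph z) x y.
Proof.
move=> x0 y0 xy e; apply/asboolP; split=> //.
  exact: zd_vertexl e.
exact: zd_vertexr e.
Qed.

Lemma dicycle2 r x y : zd_arc z r x y -> zd_arc z r y x ->
  dicycle (Digraph (@zd_arc_vertices S z r) (@zd_arc_irrefl S z r)) [:: x; y].
Proof.
move=> xy yx; rewrite /dicycle /ucycleb /= xy yx !inE !andbT /=.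
by case/asboolP: xy => _ _ /eqP.
Qed.

(** * Cycles of length at most four *)

(** Both digraphs are covered at once: [P x u] reads as [u] being a nonzero
    element standing for [x], namely [x] itself in the zero-divisor digraph and
    a power of [x] in the extended one. *)
Lemma short_dicycle_of_path (P : S -> S -> Prop) r x1 x2 x3 x4 u1 u2 u3 u4 :
    let G := Digraph (@zd_arc_vertices S z r) (@zd_arc_irrefl S z r) in
    (forall x, x <> z -> P x x) -> (forall x u, P x u -> u <> z) ->
    (forall x u y v, P x u -> P y v -> u * v = z -> r x y) ->
    uniq [:: x1; x2; x3; x4] ->
    Defs.arc G x1 x2 -> Defs.arc G x2 x3 -> Defs.arc G x3 x4 ->
    P x1 u1 -> P x2 u2 -> P x3 u3 -> P x4 u4 ->
    u1 * u2 = z -> u2 * u3 = z -> u3 * u4 = z ->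
  exists2 c, dicycle G c & size c <= 4.
Proof.
move=> G Pid Pn0 Pr u a12 a23 a34 P1 P2 P3 P4 e12 e23 e34.
have /asboolP[v1 v2 _ _] := a12; have /asboolP[v3 v4 n34 _] := a34.
have /asboolP[_ _ n23 _] := a23.
have n14 : x4 <> x1 by move=> E; move: u; rewrite E /= !inE eqxx !orbT.
have [w0|/eqP w0] := eqVneq (u4 * u1) z.
  exists [:: x1; x2; x3; x4] => //; rewrite /dicycle /ucycleb u andbT /=.
  rewrite [zd_arc _ _ _ _]a12 [zd_arc _ _ _ _]a23 [zd_arc _ _ _ _]a34 /= andbT.
  by apply/asboolP; split=> //; exact: Pr P4 P1 w0.
have w2 : u4 * u1 * u2 = z by rewrite -mulgA e12 mulxz.
have w3 : u3 * (u4 * u1) = z by rewrite mulgA e34 mulz.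
have short2 : r x3 x2 -> exists2 c, dicycle G c & size c <= 4.
  move=> r32; exists [:: x2; x3] => //; apply: dicycle2 => //.
  by apply/asboolP; split=> // /esym.
have [E|/eqP n2] := eqVneq (u4 * u1) x2.
  apply: short2; apply: (Pr _ _ _ _ P3 (Pid _ _) _); last by rewrite -E.
  by case: v2.
have [E|/eqP n3] := eqVneq (u4 * u1) x3.
  apply: short2; apply: (Pr _ _ _ _ (Pid _ _) P2 _); last by rewrite -E.
  by case: v3.
have vw : zd_vertices z (u4 * u1) by apply: zd_vertexl w2 => //; apply: Pn0 P2.
exists [:: x2; x3; u4 * u1] => //.
rewrite /dicycle /ucycleb /= !inE [zd_arc _ _ _ _]a23 /= andbT.
have -> : zd_arc z r x3 (u4 * u1).
  by apply/asboolP; split=> //; [exact/nesym | exact: Pr P3 (Pid _ w0) w3].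
have -> : zd_arc z r (u4 * u1) x2.
  by apply/asboolP; split=> //; exact: Pr (Pid _ w0) P2 w2.
rewrite negb_or /= andbT -!(eq_sym (u4 * u1)).
by move/eqP: n23 => ->; move/eqP: n2 => ->; move/eqP: n3 => ->.
Qed.

Lemma short_dicycle_zd : has_dicycle (zd_digraph z) ->
  exists2 c, dicycle (zd_digraph z) c & size c <= 4.
Proof.
case=> c Gc; have [|c4] := leqP (size c) 4; first by exists c.
case: c c4 Gc => [|x1 [|x2 [|x3 [|x4 c]]]] // _.
case/andP=> _ /andP[/= /and4P[a12 a23 a34 _]] u.
have /asboolP[[_ n1] [_ n2] _ e12] := a12.
have /asboolP[[_ n3] [_ n4] _ e34] := a34.
have /asboolP[_ _ _ e23] := a23.
apply: (@short_dicycle_of_path (fun x u => x = u /\ u <> z) _ x1 x2 x3 x4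
          x1 x2 x3 x4) => //.
- by move=> x v [].
- by move=> x v y w [-> _] [-> _].
- by have : uniq ([:: x1; x2; x3; x4] ++ c) := u; rewrite cat_uniq => /and3P[].
Qed.

Definition nonzero_spow x u := exists n, [/\ 0 < n, u = spow x n & u <> z].

Definition mul0_rel : rel S := fun u v => `[< [/\ u <> z, v <> z & u * v = z] >].

(** A cycle of the extended digraph lifts to a closed walk of nonzero powers
    with zero products: the power of [x] must serve both the arc into [x] and
    the arc out of [x], and the larger of the two exponents does. *)
Lemma power_lift c : dicycle (ext_zd_digraph z) c ->
  exists f : S -> S, (forall x, x \in c -> nonzero_spow x (f x)) /\
                     cycle mul0_rel (map f c).
Proof.
case/andP=> _ /andP[cyc uc].
have ex x y : exists p : nat * nat, ezd_rel z x y ->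
    [/\ 0 < p.1, 0 < p.2, spow x p.1 <> z, spow y p.2 <> z
      & spow x p.1 * spow y p.2 = z].
  have [[n [m ?]]|no] := pselect (ezd_rel z x y); first by exists (n, m).
  by exists (0, 0).
have [e He] := choice (fun q : S * S => ex q.1 q.2).
have arcE x : x \in c -> ezd_rel z x (next c x).
  by move=> xc; have /asboolP[] := next_cycle cyc xc.
pose a x := maxn (e (prev c x, x)).2 (e (x, next c x)).1.
have out x (xc : x \in c) := He (x, next c x) (arcE x xc).
have into x : x \in c ->
    [/\ 0 < (e (prev c x, x)).2 & spow x (e (prev c x, x)).2 <> z].
  move=> xc; have pc : prev c x \in c by rewrite mem_prev.
  by have := arcE _ pc; rewrite next_prev // => /(He (prev c x, x))[].
have pow x : x \in c -> nonzero_spow x (spow x (a x)).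
  move=> xc; have [n0 _ nz _ _] := out x xc; have [m0 mz] := into x xc.
  exists (a x); split=> //; first by rewrite /a leq_max m0.
  by rewrite /a /maxn; case: ifP.
exists (fun x => spow x (a x)); split=> //.
rewrite cycle_map; apply: cycle_from_next => // x xc /=.
have nc : next c x \in c by rewrite mem_next.
apply/asboolP; split; [by have [? []] := pow x xc | by have [? []] := pow _ nc |].
have [n0 m0 _ _ e0] := out x xc.
apply: (spow_mul0l n0); first exact: leq_maxr.
apply: (spow_mul0r m0) => //.
by rewrite /a prev_next // leq_maxl.
Qed.

Lemma short_dicycle_ezd : has_dicycle (ext_zd_digraph z) ->
  exists2 c, dicycle (ext_zd_digraph z) c & size c <= 4.
Proof.
case=> c Gc; have [|c4] := leqP (size c) 4; first by exists c.
have [f [fpow fcyc]] := power_lift Gc.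
case: c c4 Gc fpow fcyc => [|x1 [|x2 [|x3 [|x4 c]]]] // _.
case/andP=> _ /andP[/= /and4P[a12 a23 a34 _]] u fpow /and4P[].
case/asboolP=> _ _ e12 /asboolP[_ _ e23] /asboolP[_ _ e34] _.
apply: (@short_dicycle_of_path nonzero_spow (ezd_rel z) x1 x2 x3 x4
          (f x1) (f x2) (f x3) (f x4)) => //; try by apply: fpow; rewrite !inE eqxx ?orbT.
- by move=> x x0; exists 1%N.
- by move=> x v [n []].
- by move=> x v y w [n [n0 -> nz]] [m [m0 -> mz]] e; exists n, m.
- by have : uniq ([:: x1; x2; x3; x4] ++ c) := u; rewrite cat_uniq => /and3P[].
Qed.

(** * From extended cycles to cycles *)

(** If [k] is the least exponent with [x ^ k = 0], then [k > 2] and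
    [x ^ k.-1] is annihilated by [x] on both sides; it differs from [x], as
    otherwise [x * x] would vanish. *)
Lemma dicycle_of_nilpotent x u : nonzero_spow x u -> u <> x -> u * u = z ->
  has_dicycle (zd_digraph z).
Proof.
case=> a [a0 ua uz] ux uu.
have a2 : 1 < a by case: a a0 ua => [|[|a]] //= _ ua; case: ux.
have xz : x <> z.
  move=> xz; apply: uz; rewrite ua; case: a {ua} a0 a2 => // a _ a0.
  by rewrite spowS // xz mulz.
have ex : exists k, (0 < k) && (spow x k == z).
  by exists (a + a); rewrite addn_gt0 a0 spowD // -ua uu eqxx.
case: (ex_minnP ex) => k /andP[k0 /eqP xk] kmin.
have ka : a < k.
  rewrite ltnNge; apply/negP => ka; apply: uz; rewrite ua.
  move: ka; rewrite leq_eqVlt => /predU1P[<- //|ka].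
  by rewrite -(subnK (ltnW ka)) spowD ?subn_gt0 // xk mulxz.
have k2 : 2 < k := leq_ltn_trans a2 ka.
case: k k0 xk kmin {ka} k2 => // k _ xk kmin k1.
have k0 : 0 < k by apply: ltnW.
have yz : spow x k <> z.
  by move=> /eqP e; have := kmin k; rewrite k0 e ltnn => /(_ isT).
have yx : spow x k <> x.
  move=> e; have x2 : spow x 2 = z by rewrite -xk (spowS _ k0) e.
  by have := kmin 2; rewrite x2 eqxx => /(_ isT); rewrite leqNgt k1.
exists [:: x; spow x k]; apply: dicycle2; apply: zd_arc_mul0 => //.
- exact/nesym.
- by rewrite -spowS.
- by rewrite -spowSr.
Qed.

Lemma path_zd_arc x p : path mul0_rel x p -> uniq (x :: p) ->
  path (Defs.arc (zd_digraph z)) x p.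
Proof.
elim: p x => //= y p IHp x /andP[/asboolP[x0 y0 xy] yp] /andP[].
rewrite inE negb_or => /andP[/eqP nxy _] u.
by apply/andP; split; [apply: zd_arc_mul0 | apply: IHp].
Qed.

Lemma dicycle_of_walk u v p : u <> v -> mul0_rel u v ->
  path mul0_rel v p -> last v p = u -> has_dicycle (zd_digraph z).
Proof.
move=> uv /asboolP[u0 v0 e] walk; case: (shortenP walk) => q vq uq _ lq.
exists (v :: q); apply/and3P; split=> //.
  by case: q lq {vq uq} => //= /esym.
rewrite /= rcons_path path_zd_arc //= lq.
exact: zd_arc_mul0.
Qed.

Lemma zd_has_dicycle : has_dicycle (ext_zd_digraph z) ->
  has_dicycle (zd_digraph z).
Proof.
case=> c Gc; have [f [fpow fcyc]] := power_lift Gc.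
case/andP: Gc => c2 /andP[_ uc].
case: c c2 uc fpow fcyc => [|x1 [|x2 c]] //= _ /and3P[x12 _ _] fpow.
case/andP=> r12 walk.
have P1 : nonzero_spow x1 (f x1) by apply: fpow; rewrite inE eqxx.
have P2 : nonzero_spow x2 (f x2) by apply: fpow; rewrite !inE eqxx orbT.
have [E|/eqP n12] := eqVneq (f x1) (f x2); last first.
  by apply: (dicycle_of_walk n12 r12 walk); rewrite last_rcons.
have /asboolP[_ _ e] := r12; rewrite -E in e P2.
have [E1|/eqP n1] := eqVneq (f x1) x1; last exact: (dicycle_of_nilpotent P1).
apply: (dicycle_of_nilpotent P2) => // E2.
by move: x12; rewrite -E1 E2 inE eqxx.
Qed.

Lemma zd_sub_ezd c : dicycle (zd_digraph z) c -> dicycle (ext_zd_digraph z) c.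
Proof.
case/and3P=> c2 cyc uc; apply/and3P; split=> //; apply: sub_cycle cyc => x y.
case/asboolP=> xv yv xy e; apply/asboolP; split=> //.
by exists 1%N, 1%N; split=> //; [case: xv | case: yv].
Qed.

End ZeroDivisors.

Theorem theorem5p6 (S : semigroupType) (z : S) (hz : is_zero z) :
  (has_dicycle (ext_zd_digraph z) <-> has_dicycle (zd_digraph z)) /\
  [/\ girth (zd_digraph z) \in [:: 2%:E; 3%:E; 4%:E; +oo]%E,
      girth (ext_zd_digraph z) \in [:: 2%:E; 3%:E; 4%:E; +oo]%E
    & (girth (ext_zd_digraph z) <= girth (zd_digraph z))%E].
Proof.
split; [split|split].
- exact: zd_has_dicycle.
- by case=> c /zd_sub_ezd; exists c.
- exact/girth_in_2_3_4_oo/short_dicycle_zd.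
- exact/girth_in_2_3_4_oo/short_dicycle_ezd.
- exact/girth_mono/zd_sub_ezd.
Qed.
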